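(* Let $\mathcal{L}=X_1^2+X_2^2+X_3^2$ be the sublaplacian of the three Brownian motions model on $\mathbb{R}^6$. For every smooth radial function $f:\mathbb{R}^6\to\mathbb{R}$, one has $$\Gamma_2(f,f)\ge 0$$ at every point of $\mathbb{R}^6$.
   Context: Coordinates on $\mathbb{R}^6$ are $(x_1,x_2,x_3,y_1,y_2,y_3)$; indices are taken modulo $3$ in $\{1,2,3\}$; $\partial_i=\partial_{x_i}$, $\hat\partial_i=\partial_{y_i}$. For $1\le i\le 3$ define the vector fields $$X_i=\partial_i-\frac{x_{i+1}}{2}\hat\partial_{i+2}+\frac{x_{i+2}}{2}\hat\partial_{i+1},$$ $$\theta_i=x_{i+1}\partial_{i+2}-x_{i+2}\partial_{i+1}+y_{i+1}\hat\partial_{i+2}-y_{i+2}\hat\partial_{i+1}.$$ A smooth function $f$ is called radial if $\theta_if=0$ for $i=1,2,3$. For smooth $f,g$, $$\Gamma(f,g)=\tfrac12\big(\mathcal{L}(fg)-f\mathcal{L}g-g\mathcal{L}f\big)=\sum_{i=1}^3 X_if\,X_ig,\qquad \Gamma_2(f,f)=\tfrac12\big(\mathcal{L}\Gamma(f,f)-2\Gamma(f,\mathcal{L}f)\big).$$ *)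

(* Defs.v *)
From HB Require Import structures.
From mathcomp Require Import all_boot all_order all_algebra.
From mathcomp Require Import all_classical all_reals all_analysis.

Set Implicit Arguments.
Unset Strict Implicit.
Unset Printing Implicit Defensive.

Import Order.TTheory GRing.Theory Num.Theory.
Import numFieldNormedType.Exports.

Local Open Scope ring_scope.
Local Open Scope classical_set_scope.

(* A point of R^6 is p = (x, y) with x and y of size 3. The indices 1, 2, 3
   modulo 3 are the elements of 'I_3 with its ring structure of integers modulo
   3: in i + 1 and i + 2, with i : 'I_3, the addition is cyclic. *)

Section ThreeBrownianMotions.
Variable R : realType.
Local Notation R6 := 'rV[R]_(3 + 3).
Implicit Types (f g : R6 -> R) (p : R6) (i : 'I_3).

Definition xcoord i p : R := p 0 (lshift 3 i).
Definition ycoord i p : R := p 0 (rshift 3 i).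

Definition partial (k : 'I_(3 + 3)) f : R6 -> R :=
  fun p => 'D_(delta_mx 0 k) f p.

Definition partialx i f := partial (lshift 3 i) f.
Definition partialy i f := partial (rshift 3 i) f.

(* C^oo: the partial derivatives of f of every order, including f itself for
   s = [::], exist and are continuous on the whole space. *)
Definition smooth f : Prop :=
  forall s : seq 'I_(3 + 3),
    let g := foldr partial f s in
    continuous g /\
    forall k p, derivable g p (delta_mx 0 k).

Definition X i f : R6 -> R := fun p =>
  partialx i f p
  - xcoord (i + 1) p / 2 * partialy (i + 2) f p
  + xcoord (i + 2) p / 2 * partialy (i + 1) f p.

Definition theta i f : R6 -> R := fun p =>
  xcoord (i + 1) p * partialx (i + 2) f p
  - xcoord (i + 2) p * partialx (i + 1) f p
  + ycoord (i + 1) p * partialy (i + 2) f p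
  - ycoord (i + 2) p * partialy (i + 1) f p.

Definition radial f : Prop := forall i p, theta i f p = 0.

Definition sublaplacian f : R6 -> R := fun p =>
  \sum_(i < 3) X i (X i f) p.

Definition Gamma f g : R6 -> R := fun p =>
  2^-1 * (sublaplacian (fun q => f q * g q) p
          - f p * sublaplacian g p - g p * sublaplacian f p).

(* The quadratic form Gamma_2(f, f). *)
Definition Gamma2 f : R6 -> R := fun p =>
  2^-1 * (sublaplacian (Gamma f f) p - 2 * Gamma f (sublaplacian f) p).

End ThreeBrownianMotions.

(* Main.v *)
Require Import Defs.
From HB Require Import structures.
From mathcomp Require Import all_boot all_order all_algebra.
From mathcomp Require Import all_classical all_reals all_analysis.
From mathcomp Require Import ring.

(* The fields X_i are left-invariant for a step-two nilpotent group law on R^6.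
   Let Y_i be their right-invariant counterparts, obtained by changing the signs
   of the y-components; they commute with every X_j, hence with L. The sums of
   the products X_i f * X_i g and Y_i f * Y_i g differ by
   sum_i (theta_i f * d_{y_i} g + theta_i g * d_{y_i} f), so on radial functions
   Gamma can be computed with the Y_i. Since [theta_i, X_j] is an infinitesimal
   rotation of the X_k, L f is radial when f is, and therefore
   Gamma_2(f, f) = sum_i Gamma(Y_i f, Y_i f) = sum_{i,j} (X_j Y_i f)^2. *)

Set Implicit Arguments.
Unset Strict Implicit.
Unset Printing Implicit Defensive.

Import Order.TTheory GRing.Theory Num.Theory.
Import numFieldNormedType.Exports.

Local Open Scope ring_scope.

(** * Symmetry of mixed directional derivatives *)

Section MixedDerivatives.
Context {R : realType} {V : normedModType R}.
Implicit Types (f : V -> R) (p q u v : V).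

(** The difference quotient of the restriction to a line is literally that of [f] along [u]; this
    makes the one-variable mean value theorem available. *)
Lemma is_derive_line f q u (t : R) :
  derivable f (t *: u + q) u ->
  is_derive t 1 (fun s : R => f (s *: u + q)) ('D_u f (t *: u + q)).
Proof.
set g := fun s : R => _.
have E : (fun h => h^-1 *: ((f \o shift (t *: u + q)) (h *: u)
                           - f (t *: u + q))) =
         (fun h : R => h^-1 *: ((g \o shift t) (h *: 1) - g t)).
  by apply/funext => h; rewrite /g /= [_%:A]mulr1 scalerDl addrA.
by rewrite /derivable /derive E => df; apply: DeriveDef.
Qed.

(** Two mean value theorems: one in the displacement along [u], giving [c], then one for ['D_u f]
    along [v], giving [d]. *)
Lemma second_difference f p u v (h : R) : 0 < h ->
  (forall q, derivable f q u) -> (forall q, derivable ('D_u f) q v) ->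
  exists c d, [/\ 0 < c < h, 0 < d < h &
    f (h *: u + (h *: v + p)) - f (h *: u + p) - f (h *: v + p) + f p =
    h * h * 'D_v ('D_u f) (d *: v + (c *: u + p))].
Proof.
move=> h0 du dvu.
(* The second difference is [g h - g 0], where [g] is the increment of [f] in the direction [v]. *)
pose g : R -> R := (fun s : R => f (s *: u + (h *: v + p))) -
                   (fun s : R => f (s *: u + p)).
have dg (t : R) : is_derive t 1 g
    ('D_u f (t *: u + (h *: v + p)) - 'D_u f (t *: u + p)).
  by apply: is_deriveB; apply: is_derive_line.
have [c ch Ec] := MVT h0 (fun t _ => dg t)
  (@derivable_within_continuous _ _ g `[0, h]
    (fun t _ => @ex_derive _ _ _ _ _ _ _ (dg t))).
have dk (t : R) : is_derive t 1 (fun s : R => 'D_u f (s *: v + (c *: u + p)))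
    ('D_v ('D_u f) (t *: v + (c *: u + p))).
  exact: is_derive_line.
have [d dh Ed] := MVT h0 (fun t _ => dk t)
  (@derivable_within_continuous _ _ _ `[0, h]
    (fun t _ => @ex_derive _ _ _ _ _ _ _ (dk t))).
exists c, d; split.
- by move: ch; rewrite in_itv.
- by move: dh; rewrite in_itv.
- move: Ec Ed; rewrite /g !fctE /= !scale0r !add0r subr0.
  rewrite (addrCA (c *: u)) => Ec Ed.
  rewrite -[h * h * _]mulrA [h * (h * _)]mulrC [h * _ in RHS]mulrC -Ed -Ec.
  by ring.
Qed.

(** Continuity is pulled back along the map sending a pair of coefficients to a point of the plane
    through [p]; the ranges of [c] and [d] match the points produced by [second_difference]. *)
Lemma continuous_near_plane (F : V -> R) p u v (e : R) :
  0 < e -> {for p, continuous F} ->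
  exists2 r : R, 0 < r &
    forall c d, 0 < c < r -> 0 < d < r ->
      `|F p - F (d *: v + (c *: u + p))| < e.
Proof.
move=> e0 cF.
pose G (z : R * R) : R := F (z.2 *: v + (z.1 *: u + p)).
have cG : {for ((0, 0) : R * R), continuous G}.
  apply: continuous_comp; last by rewrite /= !scale0r !add0r.
  apply: cvgD; first by apply: cvgZr_tmp; exact: cvg_snd.
  by apply: cvgD; [apply: cvgZr_tmp; exact: cvg_fst | exact: cvg_cst].
have /nbhs_ballP[r /= r0 Hr] :
    nbhs ((0, 0) : R * R) [set z | `|G (0, 0) - G z| < e]%classic.
  by move/cvgrPdist_lt : cG; exact.
exists r => // c d /andP[c0 cr] /andP[d0 dr].
have := Hr (c, d); rewrite /G /= !scale0r !add0r; apply.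
by split => /=; rewrite /ball /= sub0r normrN gtr0_norm.
Qed.

(* The second difference of f along u and v at scale h is h ^ 2 times a value of
   either mixed derivative at a point within O(h) of p. *)
Lemma derive_comm f p u v :
  (forall q, derivable f q u) -> (forall q, derivable f q v) ->
  (forall q, derivable ('D_u f) q v) -> (forall q, derivable ('D_v f) q u) ->
  {for p, continuous ('D_v ('D_u f))} -> {for p, continuous ('D_u ('D_v f))} ->
  'D_v ('D_u f) p = 'D_u ('D_v f) p.
Proof.
move=> du dv dvu duv cvu cuv; apply/eqP; rewrite -subr_eq0 -normr_le0.
apply/ler_addgt0Pr => e e0; rewrite add0r.
have e20 : 0 < e / 2 by rewrite divr_gt0.
have [r1 r10 H1] := continuous_near_plane u v e20 cvu.
have [r2 r20 H2] := continuous_near_plane v u e20 cuv.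
have dist (x y z : R) : `|x - z| < e / 2 -> `|y - z| < e / 2 -> `|x - y| <= e.
  move=> xz yz; rewrite -(subrKA z) (splitr e) (le_trans (ler_normD _ _)) //.
  by rewrite ltW // ltrD // distrC.
(* One scale serves both orders of differentiation; [h] may equal a radius, since the intermediate
   points lie strictly below [h]. *)
have [h h0 /andP[hr1 hr2]] : exists2 h : R, 0 < h & (h <= r1) && (h <= r2).
  by exists (Num.min r1 r2); rewrite ?lt_min ?r10 // !ge_min !lexx orbT.
have le_itv x r : h <= r -> 0 < x < h -> 0 < x < r.
  by move=> hr /andP[-> /lt_le_trans]; apply.
have [c [d [ch dh E]]] := second_difference p h0 du dvu.
have [c' [d' [c'h d'h E']]] := second_difference p h0 dv duv.
have A1 := H1 c d (le_itv _ _ hr1 ch) (le_itv _ _ hr1 dh).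
have A2 := H2 c' d' (le_itv _ _ hr2 c'h) (le_itv _ _ hr2 d'h).
(* The second difference is symmetric in [u] and [v], so the two formulas agree and the nonzero
   factor [h * h] cancels. *)
have EE : 'D_v ('D_u f) (d *: v + (c *: u + p)) =
          'D_u ('D_v f) (d' *: u + (c' *: v + p)).
  apply: (@mulfI _ (h * h)); first by rewrite mulf_neq0 // gt_eqF.
  apply: etrans (esym E) _; apply: etrans E'.
  by rewrite (addrCA (h *: u)); congr (_ + _); rewrite addrAC.
rewrite -{}EE in A2; exact: dist A1 A2.
Qed.

End MixedDerivatives.

(** * Smooth functions on R^6 and their partial derivatives *)

Section VectorFields.
Variable R : realType.
Local Open Scope classical_set_scope.
Local Notation R6 := 'rV[R]_(3 + 3).
Implicit Types (f g : R6 -> R) (p : R6) (i j : 'I_3) (k l : 'I_(3 + 3)).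

Definition coordf k p : R := p 0 k.

(* A class of functions stable under partial derivatives, all of whose members
   are continuous and derivable, consists of smooth functions. *)
Inductive smooth_alg : (R6 -> R) -> Prop :=
| smooth_alg_base f : smooth f -> smooth_alg f
| smooth_alg_cst (c : R) : smooth_alg (cst c)
| smooth_alg_coord k : smooth_alg (coordf k)
| smooth_algD f g : smooth_alg f -> smooth_alg g -> smooth_alg (f + g)
| smooth_algM f g : smooth_alg f -> smooth_alg g -> smooth_alg (f * g).

Lemma smooth_partial k f : smooth f -> smooth (partial k f).
Proof. by move=> sf s; have := sf (rcons s k); rewrite foldr_rcons. Qed.

Lemma smooth_continuous f : smooth f -> continuous f.
Proof. by move=> sf; apply: (sf [::]).1. Qed.

Lemma smooth_derivable f k p : smooth f -> derivable f p (delta_mx 0 k).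
Proof. by move=> sf; apply: (sf [::]).2. Qed.

(** By linearity the difference quotient is constant for nonzero [h]. *)
Lemma is_derive_coord l p (v : R6) : is_derive p v (coordf l) (coordf l v).
Proof.
have E : (fun h : R => h^-1 *: ((coordf l \o shift p) (h *: v) - coordf l p))
         @ 0^' --> coordf l v.
  apply: cvg_near_cst; near=> h.
  rewrite /coordf /= !mxE addrK -[_ *: _]/(_ * _) mulKf //.
  by near: h; exact: nbhs_dnbhs_neq.
by apply: DeriveDef; [apply/cvg_ex; exists (coordf l v) | exact: cvg_lim E].
Unshelve. all: by end_near. Qed.

Lemma partial_coord k l p : partial k (coordf l) p = (l == k)%:R.
Proof.
rewrite /partial (@derive_val _ _ _ _ _ _ _ (is_derive_coord l p _)).
by rewrite /coordf mxE eqxx.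
Qed.

Lemma smooth_alg_derivable f k p : smooth_alg f -> derivable f p (delta_mx 0 k).
Proof.
elim=> {f} [f sf|c|l|f g _ df _ dg|f g _ df _ dg].
- exact: smooth_derivable.
- exact: derivable_cst.
- exact: (@ex_derive _ _ _ _ _ _ _ (is_derive_coord l p _)).
- exact: derivableD df dg.
- exact: derivableM df dg.
Qed.

Lemma smooth_alg_continuous f : smooth_alg f -> continuous f.
Proof.
elim=> {f} [f sf|c|l|f g _ cf _ cg|f g _ cf _ cg] p.
- exact: smooth_continuous.
- exact: cst_continuous.
- exact: coord_continuous.
- exact: cvgD (cf p) (cg p).
- exact: cvgM (cf p) (cg p).
Qed.

Lemma smooth_alg_partial f k : smooth_alg f -> smooth_alg (partial k f).
Proof.
elim=> {f} [f sf|c|l|f g af df ag dg|f g af df ag dg].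
- exact/smooth_alg_base/smooth_partial.
- rewrite (_ : partial _ _ = cst 0); first exact: smooth_alg_cst.
  by apply/funext => p; rewrite /partial derive_cst.
- rewrite (_ : partial _ _ = cst (l == k)%:R); first exact: smooth_alg_cst.
  by apply/funext => p; rewrite partial_coord.
- rewrite (_ : partial _ _ = partial k f + partial k g).
    exact: smooth_algD.
  by apply/funext => p; rewrite /partial deriveD //;
    apply: smooth_alg_derivable.
- rewrite (_ : partial _ _ = f * partial k g + g * partial k f).
    by apply: smooth_algD; apply: smooth_algM.
  by apply/funext => p; rewrite /partial deriveM //;
    apply: smooth_alg_derivable.
Qed.

Lemma smooth_algP f : smooth_alg f -> smooth f.
Proof.
move=> af s /=.
have {af} : smooth_alg (foldr (@partial R) f s).
  by elim: s => //= k s; exact: smooth_alg_partial.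
by split=> [|k p]; [exact: smooth_alg_continuous | exact: smooth_alg_derivable].
Qed.

Lemma smooth_cst (c : R) : smooth (cst c : R6 -> R).
Proof. exact/smooth_algP/smooth_alg_cst. Qed.

Lemma smooth_coord k : smooth (coordf k).
Proof. exact/smooth_algP/smooth_alg_coord. Qed.

Local Opaque smooth.

Lemma smoothD f g : smooth f -> smooth g -> smooth (f + g).
Proof.
by move=> sf sg; apply/smooth_algP/smooth_algD; apply: smooth_alg_base.
Qed.

Lemma smoothM f g : smooth f -> smooth g -> smooth (f * g).
Proof.
by move=> sf sg; apply/smooth_algP/smooth_algM; apply: smooth_alg_base.
Qed.

Lemma smooth_sum (I : Type) (r : seq I) (P : pred I) (F : I -> R6 -> R) :
  (forall x, P x -> smooth (F x)) -> smooth (\sum_(x <- r | P x) F x).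
Proof.
by apply: big_ind; [exact: smooth_cst 0 | exact: smoothD].
Qed.

Lemma partialD k f g : smooth f -> smooth g ->
  partial k (f + g) = partial k f + partial k g.
Proof.
by move=> sf sg; apply/funext => p; rewrite /partial deriveD //;
  exact: smooth_derivable.
Qed.

Lemma partialM k f g : smooth f -> smooth g ->
  partial k (f * g) = f * partial k g + g * partial k f.
Proof.
by move=> sf sg; apply/funext => p; rewrite /partial deriveM //;
  exact: smooth_derivable.
Qed.

Lemma partialN k f : smooth f -> partial k (- f) = - partial k f.
Proof.
by move=> sf; apply/funext => p; rewrite /partial deriveN //;
  exact: smooth_derivable.
Qed.

Lemma partial_cst k (c : R) : partial k (cst c) = 0.
Proof. by apply/funext => p; rewrite /partial derive_cst. Qed.

Lemma partialC k l f : smooth f ->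
  partial k (partial l f) = partial l (partial k f).
Proof.
move=> sf; have sp m : smooth (partial m f) by exact: smooth_partial.
apply/funext => p; apply: derive_comm => [q|q|q|q||].
- exact: smooth_derivable sf.
- exact: smooth_derivable sf.
- exact: smooth_derivable (sp l).
- exact: smooth_derivable (sp k).
- exact: smooth_continuous (smooth_partial k (sp l)) p.
- exact: smooth_continuous (smooth_partial l (sp k)) p.
Qed.

Local Opaque partial.

(** * Vector fields: product rule and Lie bracket *)

Implicit Types a b : 'I_(3 + 3) -> R6 -> R.

(** Keeping the coefficients abstract lets the product and bracket rules be proved once for the X_i,
    the Y_i and the rotations. *)
Definition vfield a f : R6 -> R := \sum_k a k * partial k f.

Lemma vfieldE a f p : vfield a f p = \sum_k a k p * partial k f p.
Proof. by rewrite /vfield fct_sumE. Qed.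

Lemma smooth_vfield a f : (forall k, smooth (a k)) -> smooth f ->
  smooth (vfield a f).
Proof.
move=> sa sf; apply: smooth_sum => k _.
exact: smoothM (sa k) (smooth_partial k sf).
Qed.

Lemma vfieldD a f g : smooth f -> smooth g ->
  vfield a (f + g) = vfield a f + vfield a g.
Proof.
move=> sf sg; rewrite /vfield -big_split; apply: eq_bigr => k _.
by rewrite partialD // mulrDr.
Qed.

Lemma vfieldM a f g : smooth f -> smooth g ->
  vfield a (f * g) = f * vfield a g + g * vfield a f.
Proof.
move=> sf sg; rewrite /vfield !mulr_sumr -big_split; apply: eq_bigr => k _.
by rewrite partialM // mulrDr mulrCA [a k * _]mulrCA.
Qed.

(** The product rule twice. For [a = b] the last group is twice the product of the first
    derivatives, the part of L(fg) that survives in [Gamma]. *)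
Lemma vfieldMM a b f g : (forall k, smooth (b k)) -> smooth f -> smooth g ->
  vfield a (vfield b (f * g)) =
    (f * vfield a (vfield b g) + g * vfield a (vfield b f)) +
    (vfield a f * vfield b g + vfield b f * vfield a g).
Proof.
move=> sb sf sg; rewrite (vfieldM b sf sg).
move: (vfield b f) (vfield b g) (smooth_vfield sb sf) (smooth_vfield sb sg).
move=> bf bg sbf sbg; rewrite (vfieldD a (smoothM sf sbg) (smoothM sg sbf)).
rewrite (vfieldM a sf sbg) (vfieldM a sg sbf) addrACA; congr (_ + _).
by congr (_ + _); rewrite mulrC.
Qed.

Lemma vfield_opp a f : smooth f -> vfield a (- f) = - vfield a f.
Proof.
move=> sf; rewrite /vfield -sumrN; apply: eq_bigr => k _.
by rewrite partialN // mulrN.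
Qed.

Lemma vfield_cst a (c : R) : vfield a (cst c) = 0.
Proof. by apply: big1 => k _; rewrite partial_cst mulr0. Qed.

(** As the coefficients of all fields below are affine in the coordinates, this makes their brackets
    explicit. *)
Lemma vfield_coord a k : vfield a (coordf k) = a k.
Proof.
apply/funext => p; rewrite vfieldE (bigD1 k) //= partial_coord eqxx mulr1.
rewrite big1 ?addr0 // => l lk; rewrite partial_coord.
by rewrite eq_sym (negbTE lk) mulr0.
Qed.

Lemma vfield_sum a (I : Type) (r : seq I) (F : I -> R6 -> R) :
  (forall x, smooth (F x)) ->
  vfield a (\sum_(x <- r) F x) = \sum_(x <- r) vfield a (F x).
Proof.
move=> sF; elim: r => [|x r IH]; first by rewrite !big_nil vfield_cst.
by rewrite !big_cons vfieldD // ?IH //; exact: smooth_sum.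
Qed.

Lemma vfieldN a f : vfield (fun k => - a k) f = - vfield a f.
Proof. by rewrite /vfield -sumrN; apply: eq_bigr => k _; rewrite mulNr. Qed.

(** The commutator has order one: its second-order terms cancel by symmetry of mixed partials,
    leaving the field whose coefficients are those of the Lie bracket. *)
Lemma vfield_comm a b f :
  (forall k, smooth (a k)) -> (forall k, smooth (b k)) -> smooth f ->
  vfield a (vfield b f) = vfield b (vfield a f) +
  vfield (fun l => vfield a (b l) - vfield b (a l)) f.
Proof.
move=> sa sb sf; have sp k : smooth (partial k f) by exact: smooth_partial.
(* A composition splits into a second-order part and a first-order part coming from the derivatives
   of the coefficients. *)
have E c d : (forall k, smooth (d k)) -> vfield c (vfield d f) =
  \sum_l \sum_k d l * (c k * partial k (partial l f)) +
  \sum_l vfield c (d l) * partial l f.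
  move=> sd; rewrite [X in vfield c X]/vfield vfield_sum => [|k].
    2: exact: smoothM (sd k) (sp k).
  rewrite -big_split; apply: eq_bigr => l _.
  by rewrite (vfieldM _ (sd l) (sp l)) mulr_sumr [partial l f * _]mulrC.
(* Exchanging the sums in one of the two second-order parts aligns them term by term; [partialC]
   then cancels them. *)
apply/eqP; rewrite addrC -subr_eq; apply/eqP;
rewrite (E a b) // (E b a) // [X in _ - (X + _)]exchange_big /=.
rewrite opprD addrACA -sumrB big1 => [|l _]; last first.
  rewrite -sumrB big1 // => k _; rewrite partialC // mulrCA subrr //.
by rewrite add0r -sumrB; apply: eq_bigr => l _; rewrite mulrBl.
Qed.

Lemma vfield_commute a b f :
  (forall k, smooth (a k)) -> (forall k, smooth (b k)) -> smooth f ->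
  (forall k p, vfield a (b k) p = vfield b (a k) p) ->
  vfield a (vfield b f) = vfield b (vfield a f).
Proof.
move=> sa sb sf ab; rewrite (vfield_comm sa sb sf).
rewrite [X in _ + X]big1 ?addr0 // => k _.
by apply/funext => p; rewrite !fctE ab subrr mul0r.
Qed.

End VectorFields.

(** * Indices modulo 3 *)

Section CyclicIndices.
Implicit Types i j : 'I_3.

Lemma addI3 i : (i + 1 + 1 = i + 2) * (i + 1 + 2 = i) * (i + 2 + 1 = i) *
                (i + 2 + 2 = i + 1).
Proof. by case: i => [[|[|[]]]] //= h; do !split; apply/val_inj. Qed.

Lemma eqI3 i : ((i + 1 == i) = false) * ((i + 2 == i) = false) *
  ((i == i + 1) = false) * ((i == i + 2) = false) *
  ((i + 1 == i + 2) = false) * ((i + 2 == i + 1) = false).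
Proof. by case: i => [[|[|[]]]]. Qed.

Lemma caseI3 i j : [\/ j = i, j = i + 1 | j = i + 2].
Proof.
case: i j => [[|[|[]]]] //= hi [[|[|[]]]] //= hj;
  by [apply/Or31/val_inj | apply/Or32/val_inj | apply/Or33/val_inj].
Qed.

(** The starting index is arbitrary, so a sum can be expanded around the axis of a given
    rotation. *)
Lemma sumI3 (V : nmodType) i (F : 'I_3 -> V) :
  \sum_j F j = F i + F (i + 1) + F (i + 2).
Proof.
rewrite (bigD1 i) //= (bigD1 (i + 1)) ?eqI3 //= (bigD1 (i + 2)) ?eqI3 //=.
rewrite big1 ?addr0 ?(addrA (F i)) // => j.
by case: (caseI3 i j) => ->; rewrite ?eqxx ?andbF.
Qed.

End CyclicIndices.

(** * The invariant fields, the rotations and their brackets *)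

Section ThreeBrownianMotionsFields.
Variable R : realType.
Local Notation R6 := 'rV[R]_(3 + 3).
Implicit Types (f g : R6 -> R) (p : R6) (i j : 'I_3) (k l : 'I_(3 + 3)) (e : R).

Local Notation xi i := (lshift 3 i).
Local Notation yi i := (rshift 3 i).

(* e = -1 gives the left-invariant fields X_i, and e = 1 their right-invariant
   counterparts. *)
Definition Xcoef e i k : R6 -> R :=
  cst (k == xi i)%:R + cst (e / 2 * (k == yi (i + 2))%:R) * coordf (xi (i + 1))
  + cst (- (e / 2) * (k == yi (i + 1))%:R) * coordf (xi (i + 2)).

Definition rot_coef i k : R6 -> R :=
  cst (k == xi (i + 2))%:R * coordf (xi (i + 1))
  + cst (- (k == xi (i + 1))%:R) * coordf (xi (i + 2))
  + cst (k == yi (i + 2))%:R * coordf (yi (i + 1))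
  + cst (- (k == yi (i + 1))%:R) * coordf (yi (i + 2)).

Local Notation W e i := (vfield (Xcoef e i)).
Local Notation T i := (vfield (rot_coef i)).

Lemma smooth_linear_coord (c : R) k : smooth (cst c * coordf k).
Proof. by apply: smoothM; [exact: smooth_cst | exact: smooth_coord]. Qed.

Lemma smooth_Xcoef e i k : smooth (Xcoef e i k).
Proof.
have sM := smooth_linear_coord.
exact: smoothD (smoothD (smooth_cst _) (sM _ _)) (sM _ _).
Qed.

Lemma smooth_rot_coef i k : smooth (rot_coef i k).
Proof.
have sM := smooth_linear_coord.
exact: smoothD (smoothD (smoothD (sM _ _) (sM _ _)) (sM _ _)) (sM _ _).
Qed.

Lemma sum_delta (F : 'I_(3 + 3) -> R) l : \sum_k (k == l)%:R * F k = F l.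
Proof.
rewrite (bigD1 l) //= eqxx mul1r big1 ?addr0 // => k /negbTE ->.
by rewrite mul0r.
Qed.

Lemma XfieldE e i f p : W e i f p = partialx i f p
  + e / 2 * (xcoord (i + 1) p * partialy (i + 2) f p
             - xcoord (i + 2) p * partialy (i + 1) f p).
Proof.
rewrite vfieldE (eq_bigr (fun k => (k == xi i)%:R * partial k f p
  + (k == yi (i + 2))%:R * (e / 2 * xcoord (i + 1) p * partial k f p)
  + (k == yi (i + 1))%:R * - (e / 2 * xcoord (i + 2) p * partial k f p))).
  rewrite !big_split !sum_delta /= /partialx /partialy.
  move: (partial _ f p) (partial _ f p) (partial _ f p) => *.
  by move: (xcoord _ p) (xcoord _ p) => *; ring.
by move=> k _; rewrite /Xcoef !fctE /xcoord /coordf; ring.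
Qed.

Lemma Xfield_X i f : W (-1) i f = X i f.
Proof.
apply/funext => p; rewrite XfieldE /X.
by move: (partialx _ f p) (partialy _ f p) (partialy _ f p) => *; field.
Qed.

Lemma rot_theta i f : T i f = theta i f.
Proof.
apply/funext => p.
rewrite vfieldE (eq_bigr (fun k =>
    (k == xi (i + 2))%:R * (xcoord (i + 1) p * partial k f p)
  + (k == xi (i + 1))%:R * - (xcoord (i + 2) p * partial k f p)
  + (k == yi (i + 2))%:R * (ycoord (i + 1) p * partial k f p)
  + (k == yi (i + 1))%:R * - (ycoord (i + 2) p * partial k f p))).
  by rewrite !big_split !sum_delta /= /theta.
by move=> k _; rewrite /rot_coef !fctE /xcoord /ycoord /coordf; ring.
Qed.

Lemma smooth_Xfield e i f : smooth f -> smooth (W e i f).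
Proof. exact/smooth_vfield/smooth_Xcoef. Qed.

Lemma vfield_linear_coordf a (c : R) k :
  vfield a (cst c * coordf k) = cst c * a k.
Proof.
rewrite vfieldM ?vfield_cst ?vfield_coord ?mulr0 ?addr0 //.
  exact: smooth_cst.
exact: smooth_coord.
Qed.

Lemma vfield_Xcoef a e i k :
  vfield a (Xcoef e i k) = cst (e / 2 * (k == yi (i + 2))%:R) * a (xi (i + 1))
  + cst (- (e / 2) * (k == yi (i + 1))%:R) * a (xi (i + 2)).
Proof.
have sM := smooth_linear_coord.
have s0 := smooth_cst ((k == xi i)%:R : R).
rewrite (vfieldD _ (smoothD s0 (sM _ _)) (sM _ _)) (vfieldD _ s0 (sM _ _)).
by rewrite vfield_cst add0r !vfield_linear_coordf.
Qed.

Lemma vfield_rot_coef a i k : vfield a (rot_coef i k) =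
  cst (k == xi (i + 2))%:R * a (xi (i + 1))
  + cst (- (k == xi (i + 1))%:R) * a (xi (i + 2))
  + cst (k == yi (i + 2))%:R * a (yi (i + 1))
  + cst (- (k == yi (i + 1))%:R) * a (yi (i + 2)).
Proof.
have sM := smooth_linear_coord.
have s2 c l d m := smoothD (sM c l) (sM d m).
rewrite (vfieldD _ (smoothD (s2 _ _ _ _) (sM _ _)) (sM _ _)).
rewrite (vfieldD _ (s2 _ _ _ _) (sM _ _)) (vfieldD _ (sM _ _) (sM _ _)).
by rewrite !vfield_linear_coordf.
Qed.

(** Differentiating the coefficients gives an expression antisymmetric in [i] and [j] and odd in
    [e]; exchanging the two fields flips both signs, so the bracket vanishes. *)
Lemma Xfield_commute i j f : smooth f ->
  W (-1) i (W 1 j f) = W 1 j (W (-1) i f).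
Proof.
move=> sf.
apply: (vfield_commute (smooth_Xcoef _ _) (smooth_Xcoef _ _) sf) => l p.
rewrite !vfield_Xcoef /Xcoef !fctE !eq_lshift !eq_lrshift.
by case: (caseI3 i j) => ->; rewrite ?addI3 ?eqI3 ?eqxx /=; field.
Qed.

(** A rotation about axis [i] fixes that axis. The next two lemmas give its action on the plane of
    the other two; all three hold for every [e] because the cross product is
    rotation-equivariant. *)
Lemma rot_Xfield e i f : smooth f -> T i (W e i f) = W e i (T i f).
Proof.
move=> sf.
apply: (vfield_commute (smooth_rot_coef _) (smooth_Xcoef _ _) sf) => l p.
rewrite !vfield_Xcoef !vfield_rot_coef /rot_coef /Xcoef !fctE.
rewrite !eq_lshift !eq_rshift !eq_lrshift !eq_rlshift ?addI3 ?eqI3 ?eqxx /=.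
by ring.
Qed.

Lemma rot_Xfield_next e i f : smooth f ->
  T i (W e (i + 1) f) = W e (i + 1) (T i f) - W e (i + 2) f.
Proof.
move=> sf; rewrite (vfield_comm (smooth_rot_coef _) (smooth_Xcoef _ _) sf).
rewrite -vfieldN; congr (_ + vfield _ f); apply/funext => l; apply/funext => p.
rewrite !fctE !vfield_Xcoef !vfield_rot_coef /rot_coef /Xcoef !fctE.
rewrite !eq_lshift !eq_rshift !eq_lrshift !eq_rlshift ?addI3 ?eqI3 ?eqxx /=.
by ring.
Qed.

Lemma rot_Xfield_prev e i f : smooth f ->
  T i (W e (i + 2) f) = W e (i + 2) (T i f) + W e (i + 1) f.
Proof.
move=> sf; rewrite (vfield_comm (smooth_rot_coef _) (smooth_Xcoef _ _) sf).
congr (_ + vfield _ f); apply/funext => l; apply/funext => p.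
rewrite !fctE !vfield_Xcoef !vfield_rot_coef /rot_coef /Xcoef !fctE.
rewrite !eq_lshift !eq_rshift !eq_lrshift !eq_rlshift ?addI3 ?eqI3 ?eqxx /=.
by ring.
Qed.

Lemma sublaplacianE i f : sublaplacian f = W (-1) i (W (-1) i f) +
  W (-1) (i + 1) (W (-1) (i + 1) f) + W (-1) (i + 2) (W (-1) (i + 2) f).
Proof. by apply/funext => p; rewrite /sublaplacian (sumI3 i) !Xfield_X. Qed.

End ThreeBrownianMotionsFields.

(** * [Gamma] and [Gamma2] on radial functions *)

Section RadialFunctions.
Variable R : realType.
Local Notation R6 := 'rV[R]_(3 + 3).
Implicit Types (f g : R6 -> R) (p : R6) (i j : 'I_3).
Local Notation W e i := (vfield (Xcoef e i)).
Local Notation T i := (vfield (rot_coef i)).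

Lemma radial_rot0 f i : radial f -> T i f = 0.
Proof. by move=> rf; apply/funext => p; rewrite rot_theta rf. Qed.

(** Moving [T i] through each square leaves only mixed products of the fields [i + 1] and [i + 2];
    those from the two squares have opposite signs and cancel. *)
Lemma radial_sublaplacian f : smooth f -> radial f -> radial (sublaplacian f).
Proof.
move=> sf rf i p; rewrite -rot_theta (sublaplacianE i).
have sW j : smooth (W (-1) j f) by exact: smooth_Xfield.
have sWW j k : smooth (W (-1) j (W (-1) k f)) by exact: smooth_Xfield (sW k).
have W0 j : W (-1) j (0 : R6 -> R) = 0 by exact: vfield_cst.
rewrite (vfieldD _ (smoothD (sWW _ _) (sWW _ _)) (sWW _ _)).
rewrite (vfieldD _ (sWW _ _) (sWW _ _)).
rewrite (rot_Xfield _ _ (sW i)) (rot_Xfield _ _ sf).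
rewrite (rot_Xfield_next _ _ (sW (i + 1))) (rot_Xfield_next _ _ sf).
rewrite (rot_Xfield_prev _ _ (sW (i + 2))) (rot_Xfield_prev _ _ sf).
rewrite radial_rot0 // !W0 !add0r (vfield_opp _ (sW _)).
by rewrite !fctE; ring.
Qed.

Lemma smooth_sublaplacian f : smooth f -> smooth (sublaplacian f).
Proof.
move=> sf; rewrite (sublaplacianE 0).
by apply: smoothD; first apply: smoothD; do 2 apply: smooth_Xfield.
Qed.

Lemma sublaplacianM f g p : smooth f -> smooth g ->
  sublaplacian (f * g) p = f p * sublaplacian g p + g p * sublaplacian f p
    + 2 * \sum_i W (-1) i f p * W (-1) i g p.
Proof.
move=> sf sg; rewrite /sublaplacian !mulr_sumr -!big_split.
apply: eq_bigr => i _; rewrite -!Xfield_X.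
rewrite (vfieldMM _ (smooth_Xcoef _ _) sf sg) !fctE /=.
by move: (W _ _ _ p) (W _ _ _ p) (W _ _ _ p) (W _ _ _ p) => *; ring.
Qed.

Lemma GammaE f g p : smooth f -> smooth g ->
  Gamma f g p = \sum_i W (-1) i f p * W (-1) i g p.
Proof.
move=> sf sg; rewrite /Gamma (sublaplacianM p sf sg).
by move: (sublaplacian _ p) (sublaplacian _ p) (\sum_i _) => *; field.
Qed.

Lemma radial_Gamma f g p : smooth f -> smooth g -> radial f -> radial g ->
  Gamma f g p = \sum_i W 1 i f p * W 1 i g p.
Proof.
move=> sf sg rf rg; rewrite GammaE //; apply/eqP; rewrite -subr_eq0 -sumrB.
(* Only the terms linear in [e] differ, and they regroup into the x-parts of the rotations. The
   y-parts contribute determinants antisymmetric in [f] and [g], which cancel in the symmetrized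
   sum. *)
apply/eqP; transitivity (\sum_i (theta i f p * partialy i g p
                               + theta i g p * partialy i f p)).
  (* With a symbolic base index, [addI3] brings all shifted indices to normal form; generalizing
     derivatives and coordinates then leaves an algebraic identity. *)
  move: (0 : 'I_3) => i; rewrite !(sumI3 i) !XfieldE /theta !addI3.
  do 6!move: (partialx _ _ p) => ?; do 6!move: (partialy _ _ p) => ?.
  by do 3!move: (xcoord _ p) => ?; do 3!move: (ycoord _ p) => ?; field.
by rewrite big1 // => i _; rewrite rf rg !mul0r addr0.
Qed.

Lemma sublaplacian_sum (F : 'I_3 -> R6 -> R) p : (forall i, smooth (F i)) ->
  sublaplacian (\sum_i F i) p = \sum_i sublaplacian (F i) p.
Proof.
move=> sF; rewrite /sublaplacian exchange_big; apply: eq_bigr => j _.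
rewrite -!Xfield_X (vfield_sum _ _ sF).
rewrite (vfield_sum _ _ (fun i => smooth_Xfield _ j (sF i))).
by rewrite fct_sumE; apply: eq_bigr => i _; rewrite !Xfield_X.
Qed.

Lemma sublaplacian_commute i f : smooth f ->
  W 1 i (sublaplacian f) = sublaplacian (W 1 i f).
Proof.
move=> sf; have sW j : smooth (W (-1) j f) by exact: smooth_Xfield.
have sWW j : smooth (W (-1) j (W (-1) j f)) by exact: smooth_Xfield (sW j).
rewrite !(sublaplacianE 0) (vfieldD _ (smoothD (sWW _) (sWW _)) (sWW _)).
rewrite (vfieldD _ (sWW _) (sWW _)).
have WWE j : W 1 i (W (-1) j (W (-1) j f)) = W (-1) j (W (-1) j (W 1 i f)).
  by rewrite (Xfield_commute j i sf) (Xfield_commute j i (sW j)).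
by rewrite !WWE.
Qed.

(** L of the square of Y_i f is 2 Y_i f L(Y_i f) + 2 [Gamma] (Y_i f, Y_i f); since L commutes with
    Y_i, the first terms sum to 2 [Gamma] (f, L f). *)
Lemma radial_Gamma2 f p : smooth f -> radial f ->
  Gamma2 f p = \sum_i Gamma (W 1 i f) (W 1 i f) p.
Proof.
move=> sf rf; have sW i : smooth (W 1 i f) by exact: smooth_Xfield.
have GG : Gamma f f = \sum_i W 1 i f * W 1 i f.
  by apply/funext => q; rewrite (radial_Gamma q sf sf rf rf) fct_sumE.
have GL : Gamma f (sublaplacian f) p =
    \sum_i W 1 i f p * sublaplacian (W 1 i f) p.
  have rL := radial_sublaplacian sf rf.
  rewrite (radial_Gamma p sf (smooth_sublaplacian sf) rf rL).
  by apply: eq_bigr => i _; rewrite (sublaplacian_commute i sf).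
rewrite /Gamma2 GG GL.
rewrite (sublaplacian_sum _ (fun i => smoothM (sW i) (sW i))).
rewrite mulr_sumr -sumrB mulr_sumr; apply: eq_bigr => i _.
(* Y_i f need not be radial, so its [Gamma] is expressed with the X_j. *)
rewrite (sublaplacianM _ (sW i) (sW i)) (GammaE _ (sW i) (sW i)).
by move: (sublaplacian _ p) (\sum_j _) (W _ _ _ p) => *; field.
Qed.

End RadialFunctions.

Theorem proposition3p1 (R : realType) (f : 'rV[R]_(3 + 3) -> R)
  (f_smooth : smooth f) (f_radial : radial f) (p : 'rV[R]_(3 + 3)) :
  0 <= Gamma2 f p.
Proof.
rewrite radial_Gamma2 //; apply: sumr_ge0 => i _.
have sW : smooth (vfield (Xcoef 1 i) f) by exact: smooth_Xfield.
by rewrite GammaE //; apply: sumr_ge0 => j _; rewrite -expr2 sqr_ge0.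
Qed.
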